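(* Let $S$ be a unilateral weighted shift on a complex Hilbert space $\mathcal{H}$ with orthonormal basis $(e_n)_{n\ge 0}$ and bounded weight sequence $(\omega_n)_{n\ge 0}$ of positive real numbers, i.e. $Se_n=\omega_n e_{n+1}$ for all $n\ge 0$. For every non-zero $x=\sum_{n\ge 0}a_ne_n\in\mathcal{H}$: (a) If $r_3(S)<R_\omega(x)$, then $\sigma_S(x)=\{\lambda\in\mathbb{C}:|\lambda|\le r_3(S)\}$. (b) If $r_3(S)\ge R_\omega(x)$, then $\{\lambda\in\mathbb{C}:|\lambda|\le R_\omega(x)\}\subset\sigma_S(x)$.
   Context: Put $\beta_0=1$ and $\beta_n=\omega_0\cdots\omega_{n-1}$ for $n>0$. Define $r_3(S)=\limsup_{n\to\infty}\beta_n^{1/n}$, and for non-zero $x=\sum_{n\ge0}a_ne_n$ define $R_\omega(x)=\liminf_{n\to+\infty}|\beta_n/a_n|^{1/n}\in[0,+\infty]$, with the convention that $|\beta_n/a_n|^{1/n}=+\infty$ when $a_n=0$. For a bounded linear operator $T$ on $\mathcal{H}$ and $x\in\mathcal{H}$, the local resolvent set $\rho_T(x)$ is the union of all open $U\subset\mathbb{C}$ for which there is an analytic $f:U\to\mathcal{H}$ with $(T-\lambda)f(\lambda)=x$ for all $\lambda\in U$; the local spectrum is $\sigma_T(x)=\mathbb{C}\setminus\rho_T(x)$. *)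

(* Defs.v *)
From HB Require Import structures.
From mathcomp Require Export all_boot all_order all_algebra.
From mathcomp Require Export complex.
From mathcomp Require Export all_classical all_reals all_analysis.
Export Order.TTheory GRing.Theory Num.Theory numFieldNormedType.Exports.

Set Implicit Arguments.
Unset Strict Implicit.
Unset Printing Implicit Defensive.

Local Open Scope classical_set_scope.
Local Open Scope complex_scope.
Local Open Scope ring_scope.

(* The topology of R[i] is the one of its norm. *)
HB.instance Definition _ (R : realType) := NormedModule.copy R[i] R[i]^o.

(* The modulus of a complex number as an element of R; the norm `|z| of
   z : R[i] is itself an element of R[i]. *)
Definition cabs (R : realType) (z : R[i]) : R := ComplexField.Normc.normc z.

(* A complex Hilbert space is a complete normed space H over R[i] whose norm
   comes from a positive definite Hermitian form, linear on the left. *)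
Definition inner_product_norm (R : realType) (H : completeNormedModType R[i])
    (dot : {dot H for (@Num.conj R[i])}) : Prop :=
  forall x : H, dot x x = `|x| ^+ 2.

Definition orthonormal_basis (R : realType) (H : completeNormedModType R[i])
    (dot : {dot H for (@Num.conj R[i])}) (e : nat -> H) : Prop :=
  (forall i j, dot (e i) (e j) = (i == j)%:R) /\
  closure [set v : H | exists n (c : nat -> R[i]),
                         v = \sum_(i < n) c i *: e i] = [set: H].

Definition bounded_operator (R : realType) (H : completeNormedModType R[i])
    (T : {linear H -> H}) : Prop :=
  exists M : R, forall x : H, `|T x| <= M%:C * `|x|.

Definition weighted_shift (R : realType) (H : completeNormedModType R[i])
    (e : nat -> H) (w : nat -> R) (S : {linear H -> H}) : Prop :=
  bounded_operator S /\ forall n, S (e n) = (w n)%:C *: e n.+1.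

Definition beta (R : realType) (w : nat -> R) (n : nat) : R :=
  \prod_(i < n) w i.

(* In r3 and R_omega the value at n = 0 is a junk one ((0%:R)^-1 = 0), which
   does not affect the limits. *)
Definition r3 (R : realType) (w : nat -> R) : \bar R :=
  limn_esup (fun n => (beta w n `^ n%:R^-1)%:E).

(* [a] is the sequence of coefficients of x in the basis (e_n). *)
Definition R_omega (R : realType) (w : nat -> R) (a : nat -> R[i]) : \bar R :=
  limn_einf (fun n => if a n == 0 then +oo%E
                      else ((cabs ((beta w n)%:C / a n)) `^ n%:R^-1)%:E).

(* Analyticity on an open set U: f is locally the sum of a power series with
   coefficients in H.  Only the values of f on U matter. *)
Definition analytic_on (R : realType) (H : completeNormedModType R[i])
    (U : set R[i]) (f : R[i] -> H) : Prop :=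
  forall l0, U l0 -> exists c : nat -> H,
    \forall l \near l0, series (fun n => (l - l0) ^+ n *: c n) @ \oo --> f l.

Definition local_resolvent (R : realType) (H : completeNormedModType R[i])
    (T : {linear H -> H}) (x : H) : set R[i] :=
  \bigcup_(U in [set U : set R[i] | open U /\
                   exists f : R[i] -> H, analytic_on U f /\
                     forall l, U l -> T (f l) - l *: f l = x]) U.

Definition local_spectrum (R : realType) (H : completeNormedModType R[i])
    (T : {linear H -> H}) (x : H) : set R[i] :=
  ~` local_resolvent T x.

Definition closed_disc (R : realType) (r : \bar R) : set R[i] :=
  [set l : R[i] | ((cabs l)%:E <= r)%E].

(* Main.v *)
Require Import Defs.
From HB Require Import structures.
From mathcomp Require Import ring lra.

(** Write [A k = a k / beta k] and [P] for the power series with coefficients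
    [A k]; by Cauchy-Hadamard its radius of convergence is [R_omega].

    Inclusion of the discs.  If [S v - l *: v = x], comparing coefficients in
    the basis gives
      l ^+ n.+1 * dot v (e n) = - beta n * (A 0 + A 1 * l + ... + A n * l ^+ n)
    ([solution_coef]).  The coefficients of [v] are bounded, whereas
    [beta n / |l| ^+ n] is large for infinitely many [n] as soon as [|l| < r3];
    so, when moreover [|l| < R_omega], the convergent partial sums on the right
    tend to [0] along a subsequence and [P] vanishes at [l]
    ([solution_psum_eq0]).  A point [l0 <> 0] of the local resolvent set with
    [|l0| <= r3] and [|l0| <= R_omega] has, inside the open disc, nearby points
    that are still in the local resolvent set; thus [P] vanishes on a small
    disc, hence identically ([identity_theorem]), and [x = 0].  At [l0 = 0] the
    open disc may be empty; there, a solution that is bounded near [0] makes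
    the [n]-th partial sum, a polynomial of degree at most [n], of order
    [l ^+ n.+1], which again forces all [A k] to be [0] ([local_resolvent0]).

    Exterior of the disc.  If [r3 < R_omega], take [r3 < s < t < R_omega]; then
    [A k] is at most of order [1 / t ^+ k] and [beta k] at most of order
    [s ^+ k], and summing [S ^ j x] along the basis shows that the orbit of [x]
    is at most of order [s ^+ j].  For such an [x] the Neumann series
    [- \sum_j S ^ j x / l ^+ j.+1] converges on [|l| > s] and solves the
    resolvent equation analytically, whatever the bounded operator
    ([orbit_bound_local_resolvent]). *)

Set Implicit Arguments.
Unset Strict Implicit.
Unset Printing Implicit Defensive.

Local Open Scope classical_set_scope.
Local Open Scope complex_scope.
Local Open Scope ring_scope.

(** * Real-valued norms and geometric series *)

(** The norm of a normed space over [R[i]] takes values in [R[i]]; estimates by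
    means of the order of [R] need its real part, which is all of it. *)
Definition nrm (R : realType) (V : normedModType R[i]) (v : V) : R :=
  complex.Re `|v|.

Lemma gt0_realE (R : realType) (z : R[i]) : 0 < z -> z = (complex.Re z)%:C.
Proof. by move=> /ltW/ger0_Im; case: z => a b /= ->. Qed.

Section Nrm.
Variables (R : realType) (V : normedModType R[i]).
Implicit Types (u v : V).

Lemma nrmE v : `|v| = (nrm v)%:C.
Proof. by rewrite /nrm; have := ger0_Im (normr_ge0 v); case: `|v| => a b /= ->. Qed.

Lemma nrm_ge0 v : 0 <= nrm v.
Proof. by rewrite -ler0c -nrmE. Qed.

Lemma nrm0 : nrm (0 : V) = 0.
Proof. by rewrite /nrm normr0. Qed.

Lemma nrm_eq0 v : nrm v = 0 -> v = 0.
Proof. by move=> h; apply/eqP; rewrite -normr_eq0 nrmE h. Qed.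

Lemma nrmN v : nrm (- v) = nrm v.
Proof. by rewrite /nrm normrN. Qed.

Lemma nrmD u v : nrm (u + v) <= nrm u + nrm v.
Proof. by rewrite -lecR rmorphD /= -!nrmE ler_normD. Qed.

Lemma nrmB u v : nrm (u - v) <= nrm u + nrm v.
Proof. by rewrite -(nrmN v) nrmD. Qed.

Lemma nrm_distC u v : nrm (u - v) = nrm (v - u).
Proof. by rewrite -opprB nrmN. Qed.

Lemma nrm_gt0 v : v != 0 -> 0 < nrm v.
Proof.
move=> v0; rewrite lt_neqAle nrm_ge0 andbT eq_sym.
by apply: contra v0 => /eqP/nrm_eq0 ->.
Qed.

Lemma nrm_sum_le (u : nat -> V) (b : nat -> R) m n :
  (forall k, nrm (u k) <= b k) ->
  nrm (\sum_(m <= k < n) u k) <= \sum_(m <= k < n) b k.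
Proof.
move=> ub; elim/big_ind2: _ => [|x1 x2 y1 y2 h1 h2|//]; first by rewrite nrm0.
by apply: le_trans (nrmD _ _) (lerD h1 h2).
Qed.

Lemma cvg_nrmP (u : nat -> V) v :
  (u @ \oo --> v) <-> ((fun n => nrm (v - u n)) @ \oo --> (0 : R)).
Proof.
split=> [/cvgrPdist_lt uv|/cvgr0Pnorm_lt uv].
  apply/cvgr0Pnorm_lt => e e0; have e0' : 0 < e%:C :> R[i] by rewrite ltcR.
  near=> n; rewrite ger0_norm ?nrm_ge0// -ltcR -nrmE.
  by near: n; exact: uv.
apply/cvgrPdist_lt => e e0.
have eE := gt0_realE e0.
rewrite eE ltcR in e0 *.
near=> n; rewrite nrmE eE ltcR -[nrm _]ger0_norm ?nrm_ge0//.
by near: n; exact: uv.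
Unshelve. all: by end_near. Qed.

Lemma cvg_nrm_le (u : nat -> V) v (d : nat -> R) :
  (forall n, nrm (v - u n) <= d n) -> d @ \oo --> (0 : R) -> u @ \oo --> v.
Proof.
move=> ud d0; apply/cvg_nrmP; apply: (@squeeze_cvgr _ _ _ _ (fun=> 0) d) => //.
  by near=> n; rewrite nrm_ge0 ud.
exact: cvg_cst.
Unshelve. all: by end_near. Qed.

Lemma cvg_nrm_bound (u : nat -> V) v (M : R) :
  u @ \oo --> v -> (forall n, nrm (u n) <= M) -> nrm v <= M.
Proof.
move=> /cvg_nrmP /cvgr0Pnorm_lt uv uM; rewrite leNgt; apply/negP => Mv.
have := uv (nrm v - M); rewrite subr_gt0 => /(_ Mv)/filter_ex[n].
rewrite ger0_norm ?nrm_ge0// => lt1.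
have := nrmD (v - u n) (u n); rewrite subrK => /le_lt_trans.
move=> /(_ (nrm v)); rewrite ltxx => h; suff: false by [].
by apply: h; have := uM n; lra.
Qed.

End Nrm.

Lemma nrm_cabs (R : realType) (z : R[i]) : nrm z = cabs z.
Proof. by case: z. Qed.

Section NrmComplex.
Variable R : realType.
Implicit Types z : R[i].

Lemma nrmZ (V : normedModType R[i]) z (v : V) : nrm (z *: v) = nrm z * nrm v.
Proof. by apply: (@complexI R); rewrite rmorphM /= -!nrmE normrZ. Qed.

Lemma nrmM z1 z2 : nrm (z1 * z2) = nrm z1 * nrm z2.
Proof. exact: nrmZ. Qed.

Lemma nrm1 : nrm (1 : R[i]) = 1.
Proof. by rewrite /nrm normr1. Qed.

Lemma nrmX z n : nrm (z ^+ n) = nrm z ^+ n.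
Proof. by elim: n => [|n IH]; rewrite ?expr0 ?nrm1// !exprS nrmM IH. Qed.

Lemma nrmV z : nrm z^-1 = (nrm z)^-1.
Proof. by rewrite !nrm_cabs /cabs ComplexField.Normc.normcV. Qed.

Lemma nrm_real (r : R) : nrm r%:C = `|r|.
Proof. by rewrite nrm_cabs /cabs /= expr0n addr0 sqrtr_sqr. Qed.

End NrmComplex.

Lemma cvg_scaled_geometric (R : realType) (K q : R) : 0 <= q -> q < 1 ->
  (fun n => K * q ^+ n) @ \oo --> (0 : R).
Proof. by move=> q0 q1; apply: (@cvg_geometric R); rewrite ger0_norm. Qed.

Lemma geometric_sum_le (R : realType) (q : R) m n : 0 <= q -> q < 1 ->
  \sum_(m <= k < n) q ^+ k <= q ^+ m / (1 - q).
Proof.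
move=> q0 q1; have d0 : 0 < 1 - q by rewrite subr_gt0.
have [nm|mn] := leqP n m.
  by rewrite big_geq// divr_ge0 ?exprn_ge0// ltW.
rewrite ler_pdivlMr//.
have -> : (\sum_(m <= k < n) q ^+ k) * (1 - q) = q ^+ m - q ^+ n.
  transitivity (- \sum_(m <= k < n) (q ^+ k.+1 - q ^+ k)); last first.
    by rewrite (telescope_sumr (fun k => q ^+ k) (ltnW mn)) opprB.
  rewrite -sumrN mulr_suml.
  by apply: eq_bigr => k _; rewrite exprS; ring.
by rewrite gerBl exprn_ge0.
Qed.

Section Geometric.
Variables (R : realType) (V : completeNormedModType R[i]).
Variables (u : nat -> V) (K q : R).
Hypotheses (q0 : 0 <= q) (q1 : q < 1) (uK : forall n, nrm (u n) <= K * q ^+ n).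

(** One estimate serves both purposes: [m] arbitrary gives the Cauchy criterion,
    [m = 0] the bound on the sum. *)
Lemma geometric_block_le m n :
  nrm (\sum_(m <= k < n) u k) <= K / (1 - q) * q ^+ m.
Proof.
have K0 : 0 <= K by have := le_trans (nrm_ge0 _) (uK 0); rewrite mulr1.
apply: le_trans (nrm_sum_le _ _ uK) _.
rewrite -mulr_sumr -mulrA ler_wpM2l// mulrC.
exact: geometric_sum_le.
Qed.

Lemma geometric_cvg : cvgn (series u).
Proof.
apply/cauchy_cvgP/cauchy_seriesP => e e0.
have eE := gt0_realE e0.
rewrite eE ltcR in e0.
have /cvgr0Pnorm_lt/(_ _ e0) [N _ hN] := @cvg_scaled_geometric R (K / (1 - q)) q q0 q1.
exists ([set n | (N <= n)%N], setT); first by split; [exists N|exact: filterT].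
move=> [m n] /= [Nm _]; rewrite nrmE eE ltcR.
apply: le_lt_trans (geometric_block_le m n) _.
by apply: le_lt_trans (ler_norm _) _; exact: hN.
Qed.

Lemma geometric_lim_le : nrm (limn (series u)) <= K / (1 - q).
Proof.
apply: cvg_nrm_bound geometric_cvg _ => n.
by have := geometric_block_le 0 n; rewrite mulr1.
Qed.

End Geometric.

Section ComplexComplete.
Variable R : realType.

(** The real and imaginary parts of a Cauchy filter are Cauchy, since they are
    dominated by the modulus. *)
Lemma complex_complete (F : set_system R[i]) :
  ProperFilter F -> cauchy F -> cvg F.
Proof.
move=> FF /cauchy_ballP Fc.
have Re_le (z : R[i]) : `|complex.Re z| <= nrm z.
  rewrite nrm_cabs /cabs; case: z => a b /=.
  by rewrite -sqrtr_sqr ler_sqrt ?addr_ge0 ?sqr_ge0// lerDl sqr_ge0.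
have Im_le (z : R[i]) : `|complex.Im z| <= nrm z.
  rewrite nrm_cabs /cabs; case: z => a b /=.
  by rewrite -sqrtr_sqr ler_sqrt ?addr_ge0 ?sqr_ge0// lerDr sqr_ge0.
have part (p : R[i] -> R) : (forall z1 z2, p (z1 - z2) = p z1 - p z2) ->
    (forall z, `|p z| <= nrm z) -> cvg (p @ F).
  move=> pB ple; apply/cauchy_cvgP/cauchy_ballP => e e0.
  have e0' : 0 < e%:C :> R[i] by rewrite ltcR.
  have := Fc _ e0'; rewrite !near_simpl => -[[A B] [FA FB] AB].
  exists (p @` A, p @` B).
    by split; [apply: filterS FA|apply: filterS FB] => z hz; exists z.
  move=> [_ _] [[z1 h1 <-] [z2 h2 <-]] /=.
  have := AB (z1, z2) (conj h1 h2).
  rewrite /ball /= /ball_ -pB => h; apply: le_lt_trans (ple _) _.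
  by rewrite -ltcR -nrmE.
have decomp (a b : R) (z : R[i]) :
    Complex a b - z = (a - complex.Re z)%:C + (b - complex.Im z)%:C * 'i%C.
  by case: z => c d; rewrite /=; simpc.
have /cvg_ex[a Ha] : cvg (@complex.Re R @ F) by apply: part => // -[? ?] [? ?].
have /cvg_ex[b Hb] : cvg (@complex.Im R @ F) by apply: part => // -[? ?] [? ?].
apply/cvg_ex; exists (Complex a b); apply/cvgrPdist_lt => e e0.
have eE := gt0_realE e0.
rewrite eE ltcR in e0.
move/cvgrPdist_lt in Ha; move/cvgrPdist_lt in Hb.
have e2 : 0 < complex.Re e / 2 by rewrite divr_gt0.
near=> z.
have ha : `|a - complex.Re z| < complex.Re e / 2 by near: z; exact: Ha.
have hb : `|b - complex.Im z| < complex.Re e / 2 by near: z; exact: Hb.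
rewrite nrmE eE ltcR decomp.
apply: le_lt_trans (nrmD _ _) _; rewrite nrmM !nrm_real.
have -> : nrm ('i%C : R[i]) = 1.
  by rewrite nrm_cabs /cabs /= expr0n expr1n add0r sqrtr1.
by rewrite mulr1; lra.
Unshelve. all: by end_near. Qed.

HB.instance Definition _ := Uniform_isComplete.Build R[i] complex_complete.
End ComplexComplete.

(** Vanishing is proved below by bounding a norm by all the terms of a
    geometric sequence. *)
Lemma le0_geometric (R : realType) (r K q : R) : 0 <= q -> q < 1 ->
  (forall n, r <= K * q ^+ n) -> r <= 0.
Proof.
move=> q0 q1 rK; rewrite leNgt; apply/negP => r0.
have /cvgr0Pnorm_lt/(_ _ r0)/filter_ex[n] := cvg_scaled_geometric K q0 q1.
by move=> /(le_lt_trans (ler_norm _)); rewrite ltNge rK.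
Qed.

(** * Local resolvents of vectors with a geometrically bounded orbit *)

Section LocalResolvent.
Variables (R : realType) (H : completeNormedModType R[i]) (T : {linear H -> H}).
Hypothesis Tb : bounded_operator T.
Implicit Types (u v x y : H) (l h : R[i]) (s C : R).

Lemma bounded_cvg (u : nat -> H) v :
  u @ \oo --> v -> (fun n => T (u n)) @ \oo --> T v.
Proof.
case: Tb => M TM /cvg_nrmP uv; apply: (@cvg_nrm_le _ _ _ _ (fun n => M * nrm (v - u n))).
  by move=> n; rewrite -linearB -lecR rmorphM /= -!nrmE TM.
by rewrite -[X in _ --> X](mulr0 M); exact: cvgMr.
Qed.

Lemma iter_bounded_cvg k (u : nat -> H) v :
  u @ \oo --> v -> (fun n => iter k T (u n)) @ \oo --> iter k T v.
Proof. by move=> uv; elim: k => //= k IH; exact: bounded_cvg. Qed.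

Lemma iter_linearZ k l v : iter k T (l *: v) = l *: iter k T v.
Proof. by elim: k => //= k ->; rewrite linearZ. Qed.

Lemma iter_linearD k u v : iter k T (u + v) = iter k T u + iter k T v.
Proof. by elim: k => //= k ->; rewrite linearD. Qed.

Lemma iter_linear_sum k m n (u : nat -> H) :
  iter k T (\sum_(m <= j < n) u j) = \sum_(m <= j < n) iter k T (u j).
Proof. by elim: k => //= k ->; rewrite linear_sum. Qed.

Lemma sub_scalarD l u v :
  T (u + v) - l *: (u + v) = (T u - l *: u) + (T v - l *: v).
Proof. by rewrite linearD scalerDr opprD addrACA. Qed.

Lemma sub_scalarB l u v :
  T (u - v) - l *: (u - v) = (T u - l *: u) - (T v - l *: v).
Proof. by rewrite sub_scalarD linearN scalerN -opprD. Qed.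

Definition orbit_bound s C v := forall j, nrm (iter j T v) <= C * s ^+ j.

Lemma orbit_boundD s C1 C2 u v :
  orbit_bound s C1 u -> orbit_bound s C2 v -> orbit_bound s (C1 + C2) (u + v).
Proof.
move=> hu hv j; rewrite iter_linearD mulrDl.
exact: le_trans (nrmD _ _) (lerD (hu j) (hv j)).
Qed.

Lemma orbit_boundZ s C l v :
  orbit_bound s C v -> orbit_bound s (nrm l * C) (l *: v).
Proof. by move=> hv j; rewrite iter_linearZ nrmZ -mulrA ler_wpM2l ?nrm_ge0. Qed.

(** Uniqueness of the resolvent equation among the vectors of geometrically
    bounded orbit: an eigenvector for [l] has an orbit of order [nrm l ^+ j],
    which exceeds [s ^+ j] unless the vector is [0]. *)
Lemma eigenvector_orbit_eq0 s C l v : 0 <= s -> s < nrm l ->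
  orbit_bound s C v -> T v = l *: v -> v = 0.
Proof.
move=> s0 sl vC Tv; have l0 : 0 < nrm l := le_lt_trans s0 sl.
apply: nrm_eq0; apply/eqP; rewrite eq_le nrm_ge0 andbT.
apply: (@le0_geometric _ _ C (s / nrm l)).
- by rewrite divr_ge0// ltW.
- by rewrite ltr_pdivrMr// mul1r.
move=> j; rewrite expr_div_n mulrA ler_pdivlMr ?exprn_gt0//.
apply: le_trans (vC j); rewrite le_eqVlt; apply/orP; left; apply/eqP.
have -> : iter j T v = l ^+ j *: v.
  elim: j => [|j IH]; first by rewrite scale1r.
  by rewrite iterS IH linearZ /= Tv scalerA exprSr.
by rewrite nrmZ nrmX mulrC.
Qed.

(** The Neumann series of the inverse of [T - l] at [y]. *)
Definition resolvent_series l y : H :=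
  - limn (series (fun j => l ^- j.+1 *: iter j T y)).

Section Resolvent.
Variables (s C : R) (l : R[i]) (y : H).
Hypotheses (s0 : 0 <= s) (sl : s < nrm l) (yC : orbit_bound s C y).

Let l0 : 0 < nrm l. Proof. exact: le_lt_trans sl. Qed.
Let q0 : 0 <= s / nrm l. Proof. by rewrite divr_ge0// ltW. Qed.
Let q1 : s / nrm l < 1. Proof. by rewrite ltr_pdivrMr// mul1r. Qed.

Let term_le k j : nrm (iter k T (l ^- j.+1 *: iter j T y)) <=
  C * s ^+ k / nrm l * (s / nrm l) ^+ j.
Proof.
rewrite iter_linearZ nrmZ -iterD nrmV nrmX.
have -> : C * s ^+ k / nrm l * (s / nrm l) ^+ j =
    (nrm l ^+ j.+1)^-1 * (C * s ^+ (k + j)).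
  have ln : nrm l != 0 by rewrite gt_eqF.
  rewrite exprD exprS expr_div_n; field.
  by rewrite ln expf_neq0.
by rewrite ler_wpM2l ?invr_ge0 ?exprn_ge0 ?nrm_ge0.
Qed.

Let resolvent_cvg : cvgn (series (fun j => l ^- j.+1 *: iter j T y)).
Proof. by apply: (geometric_cvg q0 q1) => j; exact: (term_le 0). Qed.

(** The class of vectors with an orbit of order [s ^+ j] is stable under the
    resolvent, with an explicit constant: this is what allows iteration. *)
Lemma resolvent_series_orbit :
  orbit_bound s (C / (nrm l - s)) (resolvent_series l y).
Proof.
move=> k; rewrite /resolvent_series -scaleN1r iter_linearZ scaleN1r nrmN.
have := iter_bounded_cvg (k := k) resolvent_cvg.
move/cvg_nrm_bound; apply => n.
rewrite iter_linear_sum.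
apply: le_trans (geometric_block_le q0 q1 (term_le k) 0 n) _.
rewrite expr0 mulr1 le_eqVlt; apply/orP; left; apply/eqP.
have ln : nrm l != 0 by rewrite gt_eqF.
have ls : nrm l - s != 0 by rewrite gt_eqF// subr_gt0.
by field; rewrite ls ln.
Qed.

(** The partial sums telescope, up to the term [l ^- n *: iter n T y], which
    tends to [0]. *)
Lemma resolvent_seriesP :
  T (resolvent_series l y) - l *: resolvent_series l y = y.
Proof.
have lneq0 : l != 0.
  by apply: contraTneq l0 => ->; rewrite nrm0 ltxx.
set S := series (fun j => l ^- j.+1 *: iter j T y).
have partial n : T (S n) - l *: S n = l ^- n *: iter n T y - y.
  elim: n => [|n IH].
    by rewrite /S /series /= big_geq// linear0 scaler0 expr0 invr1 scale1r !subrr.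
  rewrite /S seriesSr -/S sub_scalarD IH [T (_ *: _)]linearZ /=.
  have -> : l *: (l ^- n.+1 *: iter n T y) = l ^- n *: iter n T y.
    by rewrite scalerA exprS invfM mulrA divff// mul1r.
  by rewrite addrC subrKA.
have tail0 : (fun n => l ^- n *: iter n T y) @ \oo --> (0 : H).
  apply: (cvg_nrm_le _ (cvg_scaled_geometric C q0 q1)) => n.
  rewrite sub0r nrmN nrmZ nrmV nrmX expr_div_n mulrA mulrC.
  by rewrite ler_wpM2r ?invr_ge0 ?exprn_ge0 ?nrm_ge0.
have lim1 : (fun n => T (S n) - l *: S n) @ \oo --> (0 : H) - y.
  rewrite (_ : (fun n => _) = (fun n => l ^- n *: iter n T y - y)); last exact/funext.
  by apply: cvgB => //; exact: cvg_cst.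
have lim2 : (fun n => T (S n) - l *: S n) @ \oo --> T (limn S) - l *: limn S.
  by apply: cvgB; [exact: bounded_cvg|apply: cvgZr].
have := cvg_unique (@norm_hausdorff _ H) lim1 lim2.
rewrite /resolvent_series -/S linearN scalerN -opprD => <-.
by rewrite sub0r opprK.
Qed.

End Resolvent.

(** The iterated resolvents at [l0] are the Taylor coefficients of the
    resolvent; this bound gives them the radius of convergence
    [nrm l0 - s]. *)
Lemma resolvent_iter_orbit s C l y n : 0 <= s -> s < nrm l ->
  orbit_bound s C y ->
  orbit_bound s (C / (nrm l - s) ^+ n) (iter n (resolvent_series l) y).
Proof.
move=> s0 sl yC; elim: n => [|n IH]; first by rewrite divr1.
by rewrite iterS exprSr invfM mulrA; exact: resolvent_series_orbit.
Qed.

Section Taylor.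
Variables (s C : R) (x : H) (l0 l : R[i]).
Hypotheses (s0 : 0 <= s) (sl0 : s < nrm l0) (xC : orbit_bound s C x).
Hypothesis near_l0 : nrm (l - l0) < nrm l0 - s.

Let c n := iter n.+1 (resolvent_series l0) x.
Let rem n := (l - l0) ^+ n *: iter n (resolvent_series l0) x.
Let S := series (fun n => (l - l0) ^+ n *: c n).

Lemma nrm_gt_near : s < nrm l.
Proof.
have := nrmB l (l - l0); rewrite opprB addrC subrK => h.
by move: near_l0; lra.
Qed.

Let partial n : T (S n) - l *: S n = x - rem n.
Proof.
elim: n => [|n IH].
  by rewrite /S /rem /series /= big_geq// linear0 scaler0 expr0 scale1r !subrr.
have := resolvent_seriesP s0 sl0 (resolvent_iter_orbit n s0 sl0 xC).
rewrite -iterS -/(c n) => cE.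
have step : T ((l - l0) ^+ n *: c n) - l *: ((l - l0) ^+ n *: c n) =
    rem n - rem n.+1.
  have TE : T (c n) = iter n (resolvent_series l0) x + l0 *: c n.
    by rewrite -[in RHS]cE subrK.
  rewrite linearZ /= TE scalerDr -/(rem n) -addrA; congr (rem n + _).
  rewrite /rem -/(c n) !scalerA -scalerBl -[RHS]scaleNr; congr (_ *: _).
  by rewrite exprSr; ring.
by rewrite /S seriesSr -/S sub_scalarD IH step subrKA.
Qed.

Let S_orbit n : exists D, orbit_bound s D (S n).
Proof.
elim: n => [|n [D HD]].
  exists 0 => j; rewrite /S /series /= big_geq// mul0r.
  by rewrite -(scale0r (0 : H)) iter_linearZ scale0r nrm0.
have cC := resolvent_iter_orbit n.+1 s0 sl0 xC.
exists (D + nrm ((l - l0) ^+ n) * (C / (nrm l0 - s) ^+ n.+1)).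
by rewrite /S seriesSr; apply: orbit_boundD => //; exact: orbit_boundZ.
Qed.

(** The [n]-th partial sum solves the equation for [x] minus the remainder
    [(l - l0) ^+ n *: iter n (resolvent_series l0) x]; by uniqueness its
    distance to the resolvent of [x] is the resolvent of that remainder, which
    is geometrically small.  No double series has to be rearranged. *)
Lemma resolvent_series_taylor :
  series (fun n => (l - l0) ^+ n *: iter n.+1 (resolvent_series l0) x) @ \oo
    --> resolvent_series l x.
Proof.
have sl := nrm_gt_near.
have d0 : 0 < nrm l0 - s by rewrite subr_gt0.
have q0 : 0 <= nrm (l - l0) / (nrm l0 - s) by rewrite divr_ge0 ?nrm_ge0 ?ltW.
have q1 : nrm (l - l0) / (nrm l0 - s) < 1 by rewrite ltr_pdivrMr ?mul1r.
apply: (cvg_nrm_le _ (cvg_scaled_geometric (C / (nrm l - s)) q0 q1)) => n.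
have remC : orbit_bound s (C * (nrm (l - l0) / (nrm l0 - s)) ^+ n) (rem n).
  have := orbit_boundZ ((l - l0) ^+ n) (resolvent_iter_orbit n s0 sl0 xC).
  by rewrite nrmX expr_div_n mulrCA.
have -> : resolvent_series l x - S n = resolvent_series l (rem n).
  have [D SD] := S_orbit n.
  have h1 := orbit_boundZ (-1) (orbit_boundD SD (resolvent_series_orbit s0 sl remC)).
  have h2 := orbit_boundD (resolvent_series_orbit s0 sl xC) h1.
  apply/eqP; rewrite -subr_eq0 -addrA -opprD -scaleN1r; apply/eqP.
  apply: (eigenvector_orbit_eq0 s0 sl h2); apply/eqP; rewrite -subr_eq0; apply/eqP.
  rewrite scaleN1r sub_scalarB sub_scalarD (resolvent_seriesP s0 sl xC) partial.
  by rewrite (resolvent_seriesP s0 sl remC) subrK subrr.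
have := resolvent_series_orbit s0 sl remC 0.
by rewrite expr0 mulr1 mulrAC.
Qed.

End Taylor.

(** The ball of centre [l] and radius [nrm l - s] stays where the Neumann series
    converges and is analytic. *)
Theorem orbit_bound_local_resolvent s C x l : 0 <= s ->
  orbit_bound s C x -> s < nrm l -> local_resolvent T x l.
Proof.
move=> s0 xC sl.
have d0 : 0 < (nrm l - s)%:C by rewrite ltcR subr_gt0.
have inU l' : ball l (nrm l - s)%:C l' -> s < nrm l'.
  rewrite -ball_normE /ball_ /= nrmE ltcR => h.
  by apply: (@nrm_gt_near _ l); rewrite nrm_distC.
exists (ball l (nrm l - s)%:C); last exact: ballxx.
split; first exact: ball_open.
exists (resolvent_series ^~ x); split=> l' /inU sl'; last exact: resolvent_seriesP sl' xC.
exists (fun n => iter n.+1 (resolvent_series l') x).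
have d' : 0 < (nrm l' - s)%:C by rewrite ltcR subr_gt0.
apply: filterS (nbhsx_ballx l' _ d') => l''.
rewrite -ball_normE /ball_ /= nrmE ltcR nrm_distC => h.
exact: resolvent_series_taylor xC h.
Qed.

End LocalResolvent.

(** * The identity theorem for power series *)

Section PowerSeries.
Variables (R : realType) (s : R).
Hypothesis s0 : 0 < s.
Implicit Types (B : nat -> R[i]) (C : R) (a z : R[i]).

Definition psum B z : R[i] := limn (series (fun k => B k * z ^+ k)).

Definition coef_bound C B := forall k, nrm (B k) <= C / s ^+ k.

Let ratio_ge0 z : 0 <= nrm z / s.
Proof. by rewrite divr_ge0 ?nrm_ge0// ltW. Qed.

Let ratio_lt1 z : nrm z < s -> nrm z / s < 1.
Proof. by move=> zs; rewrite ltr_pdivrMr// mul1r. Qed.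

Let term_le C B z k : coef_bound C B ->
  nrm (B k * z ^+ k) <= C * (nrm z / s) ^+ k.
Proof.
move=> BC; rewrite nrmM nrmX expr_div_n mulrA mulrAC.
by rewrite ler_wpM2r ?exprn_ge0 ?nrm_ge0.
Qed.

Lemma psum_cvg C B z : coef_bound C B -> nrm z < s ->
  series (fun k => B k * z ^+ k) @ \oo --> psum B z.
Proof.
move=> BC zs.
apply: (geometric_cvg (ratio_ge0 z) (ratio_lt1 zs)) => k; exact: term_le BC.
Qed.

Lemma psum_le C B z : coef_bound C B -> nrm z < s ->
  nrm (psum B z) <= C * s / (s - nrm z).
Proof.
move=> BC zs; have -> : C * s / (s - nrm z) = C / (1 - nrm z / s).
  by field; rewrite !gt_eqF// subr_gt0.
apply: (geometric_lim_le (ratio_ge0 z) (ratio_lt1 zs)) => k; exact: term_le BC.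
Qed.

Lemma coef_bound_shift C B m : coef_bound C B ->
  coef_bound (C / s ^+ m) (fun k => B (m + k)%N).
Proof.
move=> BC k; apply: le_trans (BC _) _.
by rewrite exprD invfM mulrA.
Qed.

Lemma psum_shift C B z : coef_bound C B -> nrm z < s ->
  psum B z = B 0%N + z * psum (fun k => B k.+1) z.
Proof.
move=> BC zs.
have h1 : (fun n => series (fun k => B k * z ^+ k) n.+1) @ \oo --> psum B z.
  by rewrite (cvg_shiftS (series (fun k => B k * z ^+ k))); exact: psum_cvg BC zs.
have h2 : (fun n => B 0%N + z * series (fun k => B k.+1 * z ^+ k) n) @ \oo -->
    B 0%N + z * psum (fun k => B k.+1) z.
  apply: cvgD; first exact: cvg_cst.
  by apply: cvgMr; exact: psum_cvg (coef_bound_shift 1 BC) zs.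
apply: (cvg_unique (@norm_hausdorff _ R[i]) h1).
rewrite (_ : (fun n => _) =
  (fun n => B 0%N + z * series (fun k => B k.+1 * z ^+ k) n)) //.
apply/funext => n; rewrite /series /= big_nat_recl// expr0 mulr1; congr (_ + _).
by rewrite mulr_sumr; apply: eq_bigr => k _; rewrite exprS mulrCA.
Qed.

(** The coefficients of the power series [(psum B z - psum B a) / (z - a)]. *)
Definition quotient B a k := psum (fun j => B (k.+1 + j)%N) a.

Lemma quotient_bound C B a : coef_bound C B -> nrm a < s ->
  coef_bound (C / (s - nrm a)) (quotient B a).
Proof.
move=> BC as_ k; apply: le_trans (psum_le (coef_bound_shift k.+1 BC) as_) _.
rewrite le_eqVlt; apply/orP; left; apply/eqP.
have sn : s != 0 by rewrite gt_eqF.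
rewrite exprS; field.
by rewrite expf_neq0// sn gt_eqF// subr_gt0.
Qed.

(** The tails [t k] of the series at [a] satisfy [B k = t k - a * t k.+1], so
    that an Abel summation produces the factor [z - a]. *)
Lemma psum_quotient C B a z : coef_bound C B -> nrm a < s -> nrm z < s ->
  psum B z - psum B a = (z - a) * psum (quotient B a) z.
Proof.
move=> BC as_ zs.
pose t k := psum (fun j => B (k + j)%N) a.
have tS k : B k = t k - a * t k.+1.
  rewrite /t (psum_shift (coef_bound_shift k BC) as_) addn0.
  rewrite (_ : (fun j => B (k + j.+1)%N) = (fun j => B (k.+1 + j)%N)) ?addrK//.
  by apply/funext => j; rewrite addnS.
have partial n : series (fun k => B k * z ^+ k) n =
    psum B a + (z - a) * series (fun k => quotient B a k * z ^+ k) n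
      - t n * z ^+ n.
  elim: n => [|n IH].
    by rewrite /series /= !big_geq// mulr0 addr0 expr0 mulr1 subrr.
  rewrite !seriesSr IH {1}tS -/(t n.+1) /quotient -/(t n.+1) exprS; ring.
have tail : (fun n => t n * z ^+ n) @ \oo --> (0 : R[i]).
  apply: (cvg_nrm_le _ (cvg_scaled_geometric (C * s / (s - nrm a)) (ratio_ge0 z)
    (ratio_lt1 zs))) => n.
  rewrite sub0r nrmN nrmM nrmX.
  have := psum_le (coef_bound_shift n BC) as_; rewrite -/(t n) => h.
  rewrite expr_div_n.
  have -> : C * s / (s - nrm a) * (nrm z ^+ n / s ^+ n) =
     C / s ^+ n * s / (s - nrm a) * nrm z ^+ n by ring.
  by rewrite ler_wpM2r ?exprn_ge0 ?nrm_ge0.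
have h1 := psum_cvg BC zs.
have h2 : (fun n => psum B a + (z - a) * series (fun k => quotient B a k * z ^+ k) n
      - t n * z ^+ n) @ \oo --> psum B a + (z - a) * psum (quotient B a) z - 0.
  apply: cvgB tail; apply: cvgD; first exact: cvg_cst.
  by apply: cvgMr; exact: psum_cvg (quotient_bound BC as_) zs.
move: h1; rewrite (_ : series _ = (fun n => psum B a + (z - a) *
  series (fun k => quotient B a k * z ^+ k) n - t n * z ^+ n)); last exact/funext.
move=> h1; rewrite (cvg_unique (@norm_hausdorff _ R[i]) h1 h2).
by rewrite subr0 addrAC subrr add0r.
Qed.

(** Each zero [p i] near [z0] can be divided out.  This costs a factor
    [1 / (s - nrm (p i))] in the bound of the coefficients and yields a factor
    [nrm (z - p i)] in the value at [z]; hence the geometric decay in the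
    number [n] of zeros used. *)
Lemma psum_many_zeros (z0 z : R[i]) (e : R) (p : nat -> R[i]) C B n :
  nrm z < s -> nrm z0 + e < s ->
  injective p -> (forall i, nrm (p i - z0) <= e) ->
  coef_bound C B -> (forall i, psum B (p i) = 0) ->
  nrm (psum B z) <= C * s / (s - nrm z) *
    ((nrm (z - z0) + e) / (s - nrm z0 - e)) ^+ n.
Proof.
move=> zs z0s; elim: n C B p => [|n IH] C B p pI pe BC Bp.
  by rewrite expr0 mulr1; exact: psum_le.
have ps i : nrm (p i) <= nrm z0 + e.
  by have := nrmD (p i - z0) z0; rewrite subrK; have := pe i; lra.
have ps' i : nrm (p i) < s by apply: le_lt_trans z0s.
have Qp i : psum (quotient B (p 0%N)) (p i.+1) = 0.
  have := psum_quotient BC (ps' 0%N) (ps' i.+1); rewrite !Bp subrr => /esym/eqP.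
  by rewrite mulf_eq0 subr_eq0 (inj_eq pI) /= => /eqP.
have := IH _ _ (fun i => p i.+1) (inj_comp pI succn_inj) (fun i => pe i.+1)
  (quotient_bound BC (ps' 0%N)) Qp.
set X := _ ^+ n => le1.
have := psum_quotient BC (ps' 0%N) zs; rewrite Bp subr0 => ->.
have zp : nrm (z - p 0%N) <= nrm (z - z0) + e.
  have := nrmB (z - z0) (p 0%N - z0); rewrite opprB addrA subrK.
  by have := pe 0%N; lra.
have C0 : 0 <= C by have := le_trans (nrm_ge0 _) (BC 0%N); rewrite divr1.
have X0 : 0 <= X.
  apply: exprn_ge0; apply: divr_ge0; last by lra.
  exact: le_trans (nrm_ge0 _) zp.
rewrite nrmM exprS.
apply: le_trans (ler_pM (nrm_ge0 _) (nrm_ge0 _) zp le1) _.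
have d1 : 0 < s - nrm z by rewrite subr_gt0.
have d2 : 0 < s - nrm (p 0%N) by rewrite subr_gt0.
have d3 : 0 < s - nrm z0 - e by lra.
rewrite -/X.
have -> : (nrm (z - z0) + e) * (C / (s - nrm (p 0%N)) * s / (s - nrm z) * X) =
   C * s / (s - nrm z) * (nrm (z - z0) + e) * X / (s - nrm (p 0%N)).
  by field; rewrite !gt_eqF.
have -> : C * s / (s - nrm z) * ((nrm (z - z0) + e) / (s - nrm z0 - e) * X) =
   C * s / (s - nrm z) * (nrm (z - z0) + e) * X / (s - nrm z0 - e).
  by field; rewrite !gt_eqF.
apply: ler_wpM2l.
  rewrite !mulr_ge0 ?invr_ge0 ?(ltW d1) ?(ltW s0)//.
  exact: le_trans (nrm_ge0 _) zp.
by rewrite lef_pV2 ?posrE//; have := ps 0%N; lra.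
Qed.

(** For [z] in this disc the ratio of the preceding lemma is less than [1] once
    the zeros are taken close enough to [z0].  The hypothesis leaves [z0]
    itself aside so that the lemma may be applied again after division by
    [z - z0]. *)
Lemma psum_zero_disc C B z0 z (d : R) : coef_bound C B ->
  nrm z0 < s -> 0 < d ->
  (forall z', z' != z0 -> nrm (z' - z0) < d -> psum B z' = 0) ->
  nrm (z - z0) < s - nrm z0 -> psum B z = 0.
Proof.
move=> BC z0s d0 Bz' zz0.
have zs : nrm z < s by have := nrmD (z - z0) z0; rewrite subrK; lra.
(* With this margin, nrm (z - z0) + e is less than s - nrm z0 - e. *)
pose e := Num.min (d / 2) ((s - nrm z0 - nrm (z - z0)) / 3).
have e0 : 0 < e by rewrite lt_min !divr_gt0//; lra.
have ed : e < d by rewrite gt_min; apply/orP; left; lra.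
have e3 : e <= (s - nrm z0 - nrm (z - z0)) / 3 by rewrite ge_min lexx orbT.
(* Infinitely many distinct points of the punctured disc of radius d. *)
pose p (i : nat) := z0 + (e / i.+1%:R)%:C.
have pE i : nrm (p i - z0) = e / i.+1%:R.
  by rewrite /p addrAC subrr add0r nrm_real ger0_norm// divr_ge0// ltW.
have pI : injective p.
  move=> i j /addrI/complexI/(mulfI (lt0r_neq0 e0))/invr_inj/eqP.
  by rewrite eqr_nat eqSS => /eqP.
have pe i : nrm (p i - z0) <= e.
  by rewrite pE ler_pdivrMr// ler_peMr ?(ltW e0)// ler1n.
have nz := nrm_ge0 (z - z0).
apply: nrm_eq0; apply/eqP; rewrite eq_le nrm_ge0 andbT.
apply: (@le0_geometric _ _ (C * s / (s - nrm z))
  ((nrm (z - z0) + e) / (s - nrm z0 - e))).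
- by rewrite divr_ge0//; lra.
- by rewrite ltr_pdivrMr; lra.
move=> n; apply: (@psum_many_zeros z0 z e p) => //; first by lra.
move=> i; apply: Bz'; last exact: le_lt_trans ed.
rewrite -subr_eq0; apply/eqP => p0; have := pE i; rewrite p0 nrm0 => /esym/eqP.
by rewrite gt_eqF// divr_gt0.
Qed.

(** The constant coefficient is the value at [0]; once it is known to vanish,
    dividing by [z] shifts the coefficients. *)
Lemma psum_zero_at0 C B (d : R) : coef_bound C B -> 0 < d -> d <= s ->
  (forall z, z != 0 -> nrm z < d -> psum B z = 0) -> forall k, B k = 0.
Proof.
move=> BC d0 ds B0 k.
have const0 C' B' : coef_bound C' B' ->
    (forall z, z != 0 -> nrm z < d -> psum B' z = 0) -> B' 0%N = 0.
  move=> BC' B'0.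
  have := psum_shift (z := 0) BC'; rewrite nrm0 mul0r addr0 => /(_ s0) <-.
  apply: (psum_zero_disc (z0 := 0) (d := d) BC') => //; rewrite ?nrm0//.
    by move=> z' z'0; rewrite subr0; exact: B'0.
  by rewrite subrr nrm0 subr0.
elim: k C B BC B0 => [|k IH] C B BC B0; first exact: const0 BC B0.
apply: (IH _ (fun j => B j.+1) (coef_bound_shift 1 BC)) => z z0 zd.
have := psum_shift BC (lt_le_trans zd ds).
rewrite B0// (const0 _ _ BC B0) add0r => /esym/eqP.
by rewrite mulf_eq0 (negbTE z0) => /eqP.
Qed.

(** Zeros propagate from [z0] to [0] along the segment: by the preceding
    lemmas, all the discs of radius [s - nrm z0] centred on it are reached in
    steps shorter than this radius. *)
Lemma identity_theorem C B z0 (d : R) : coef_bound C B ->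
  nrm z0 < s -> 0 < d ->
  (forall z, nrm (z - z0) < d -> psum B z = 0) -> forall k, B k = 0.
Proof.
move=> BC z0s d0 Bz; set r := s - nrm z0.
have r0 : 0 < r by rewrite subr_gt0.
(* Steps of length nrm z0 / N.+1 are shorter than the radius r. *)
have [N hN] : exists N, nrm z0 / N.+1%:R < r.
  exists (Num.bound (nrm z0 / r)); rewrite ltr_pdivrMr//.
  rewrite mulrC -ltr_pdivrMr//.
  apply: lt_le_trans (archi_boundP _) _; last by rewrite ler_nat.
  by rewrite divr_ge0 ?nrm_ge0 ?ltW.
pose p (k : nat) := (1 - k%:R / N.+1%:R)%:C * z0.
have stepE k : nrm (p k.+1 - p k) = nrm z0 / N.+1%:R.
  rewrite /p -mulrBl -rmorphB nrmM nrm_real.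
  have -> : 1 - k.+1%:R / N.+1%:R - (1 - k%:R / N.+1%:R) = - (N.+1%:R)^-1 :> R.
    by rewrite -[k.+1]addn1 natrD; field.
  by rewrite normrN ger0_norm ?invr_ge0// mulrC.
have p_le k : (k <= N.+1)%N -> nrm (p k) <= nrm z0.
  move=> kN; rewrite /p nrmM nrm_real ger0_norm.
    by rewrite ler_piMl ?nrm_ge0// gerBl divr_ge0.
  by rewrite subr_ge0 ler_pdivrMr// mul1r ler_nat.
have chain k : (k <= N.+1)%N -> forall z, nrm (z - p k) < r -> psum B z = 0.
  elim: k => [|k IH] kN z zp.
    apply: (psum_zero_disc BC z0s d0) => [z' _|]; first exact: Bz.
    by move: zp; rewrite /p mul0r subr0 mul1r.
  have d1 : 0 < r - nrm z0 / N.+1%:R by rewrite subr_gt0.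
  apply: (psum_zero_disc (z0 := p k.+1) BC _ d1).
  - by apply: le_lt_trans z0s; exact: p_le.
  - move=> z' _ z'p; apply: (IH (ltnW kN)).
    have := nrmD (z' - p k.+1) (p k.+1 - p k); rewrite subrKA stepE => h.
    by apply: le_lt_trans h _; rewrite -ltrBrDr.
  - by apply: lt_le_trans zp _; have := p_le _ kN; rewrite /r; lra.
apply: (psum_zero_at0 BC r0); first by rewrite /r gerBl nrm_ge0.
move=> z _ zr; apply: (chain N.+1) => //.
by rewrite /p divff ?pnatr_eq0// subrr mul0r subr0.
Qed.
End PowerSeries.

(** * Coefficients in an orthonormal basis *)

Section Coefficients.
Variables (R : realType) (H : completeNormedModType R[i]).
Variables (dot : {dot H for (@Num.conj R[i])}) (e : nat -> H).
Hypotheses (Hdot : inner_product_norm dot) (He : orthonormal_basis dot e).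

Lemma dotDl u v y : dot (u + v) y = dot u y + dot v y.
Proof. exact: linearDl. Qed.

Lemma dotZl c u y : dot (c *: u) y = c * dot u y.
Proof. exact: linearZl_LR. Qed.

Lemma dotBl u v y : dot (u - v) y = dot u y - dot v y.
Proof. exact: linearBl. Qed.

Lemma dot_sum_l n (u : nat -> H) y :
  dot (\sum_(0 <= i < n) u i) y = \sum_(0 <= i < n) dot (u i) y.
Proof.
elim: n => [|n IH]; last by rewrite !big_nat_recr//= dotDl IH.
by rewrite !big_geq// linear0l.
Qed.

Lemma dotC u v : dot u v = Num.conj (dot v u).
Proof. by rewrite hermC expr0 mul1r. Qed.

Lemma dot_basis n m : dot (e n) (e m) = (n == m)%:R.
Proof. exact: He.1. Qed.

Lemma nrm_pythagoras u v : dot u v = 0 ->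
  nrm (u + v) ^+ 2 = nrm u ^+ 2 + nrm v ^+ 2.
Proof.
move=> uv0; have : dot (u + v) (u + v) = dot u u + dot v v by exact: hnormDd.
rewrite !Hdot !nrmE -!rmorphXn -rmorphD; exact: complexI.
Qed.

Lemma nrm_basis n : nrm (e n) = 1.
Proof.
have := Hdot (e n); rewrite dot_basis eqxx nrmE -rmorphXn /= => /esym/complexI/eqP.
by rewrite sqrf_eq1 => /orP[/eqP//|/eqP h]; have := nrm_ge0 (e n); lra.
Qed.

(** Bessel's inequality for a single basis vector. *)
Lemma coef_le v n : nrm (dot v (e n)) <= nrm v.
Proof.
set c := dot v (e n); pose p := v - c *: e n.
have pe : dot (c *: e n) p = 0.
  rewrite dotC /p dotBl dotZl -/c.
  rewrite [dot v (c *: _)]dotC [dot (e n) (c *: _)]dotC !dotZl dot_basis eqxx mulr1.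
  by rewrite [dot (e n) v]dotC -/c rmorphM /= conjCK mulrC subrr rmorph0.
have := nrm_pythagoras pe; rewrite /p addrC subrK nrmZ nrm_basis mulr1 => E.
by rewrite -(@ler_pXn2r _ 2) ?nnegrE ?nrm_ge0// E lerDl sqr_ge0.
Qed.

(** A bounded additive map that vanishes on a dense subset is zero; the
    relations between the coefficients of [v] and of [S v] are obtained in this
    way from the basis vectors, without expanding [v]. *)
Lemma vanish_on_span (phi : H -> R[i]) (K : R) :
  (forall u v, phi (u - v) = phi u - phi v) ->
  (forall v, nrm (phi v) <= K * nrm v) ->
  (forall n (c : nat -> R[i]), phi (\sum_(i < n) c i *: e i) = 0) ->
  forall v, phi v = 0.
Proof.
move=> phiB phiK phi0 v; apply: nrm_eq0; apply/eqP.
rewrite eq_le nrm_ge0 andbT leNgt; apply/negP => pos.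
have K1 : 0 < `|K| + 1 by rewrite ltr_wpDl.
have d0 : 0 < (nrm (phi v) / (`|K| + 1))%:C by rewrite ltcR divr_gt0.
have : closure [set v : H | exists n (c : nat -> R[i]),
    v = \sum_(i < n) c i *: e i] v by rewrite He.2.
move=> /(_ _ (nbhsx_ballx v _ d0)) [u [[n [c ->]]]].
set t := \sum_(i < n) _.
rewrite -ball_normE /ball_ /= nrmE ltcR ltr_pdivlMr// => lt1.
have := phiK (v - t); rewrite phiB phi0 subr0 => le1.
have le2 : K * nrm (v - t) <= `|K| * nrm (v - t).
  by rewrite ler_wpM2r ?nrm_ge0// ler_norm.
by have := nrm_ge0 (v - t); lra.
Qed.

Lemma coef_of_series (a : nat -> R[i]) x n :
  series (fun k => a k *: e k) @ \oo --> x -> dot x (e n) = a n.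
Proof.
move=> /cvg_nrmP/cvgr0Pnorm_lt ax; apply/eqP; rewrite -subr_eq0; apply/eqP.
apply: nrm_eq0; apply/eqP; rewrite eq_le nrm_ge0 andbT leNgt; apply/negP => pos.
have [N _ hN] := ax _ pos.
have := hN _ (leq_addr n.+1 N).
rewrite ger0_norm ?nrm_ge0// ltNge => /negP; apply.
apply: le_trans (coef_le _ n); rewrite dotBl /series /= dot_sum_l.
rewrite (bigD1_seq n) ?iota_uniq//=; last first.
  by rewrite mem_index_iota leq0n addnS ltnS leq_addl.
rewrite dotZl dot_basis eqxx mulr1 big1 ?addr0// => k kn.
by rewrite dotZl dot_basis (negbTE kn) mulr0.
Qed.

Section Shift.
Variables (w : nat -> R) (S : {linear H -> H}).
Hypotheses (w_gt0 : forall n, 0 < w n) (HS : weighted_shift e w S).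

Let S_bounded : exists M : R, 0 <= M /\ forall v, nrm (S v) <= M * nrm v.
Proof.
have [[M SM] _] := HS; exists `|M|; split=> // v.
apply: (@le_trans _ _ (M * nrm v)).
  by rewrite -lecR rmorphM /= -!nrmE; exact: SM.
by rewrite ler_wpM2r ?nrm_ge0// ler_norm.
Qed.

Lemma shift_coefS v n : dot (S v) (e n.+1) = (w n)%:C * dot v (e n).
Proof.
have [M [M0 SM]] := S_bounded; apply/eqP; rewrite -subr_eq0; apply/eqP.
pose phi u := dot (S u) (e n.+1) - (w n)%:C * dot u (e n).
apply: (@vanish_on_span phi (M + w n)) => [u u'|u|m c]; rewrite /phi.
- by rewrite linearB !dotBl; ring.
- rewrite mulrDl; apply: le_trans (nrmB _ _) (lerD _ _).
    by apply: le_trans (coef_le _ _) (SM _).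
  by rewrite nrmM nrm_real ger0_norm ?(ltW (w_gt0 n))// ler_wpM2l ?coef_le// ltW.
rewrite -(big_mkord xpredT (fun i => c i *: e i)) linear_sum /= !dot_sum_l.
rewrite mulr_sumr -sumrB big1// => i _.
rewrite linearZ /= HS.2 !dotZl !dot_basis eqSS; case: eqP => [->|_].
  by rewrite mulrCA subrr.
by rewrite !mulr0 subrr.
Qed.

Lemma shift_coef0 v : dot (S v) (e 0%N) = 0.
Proof.
have [M [M0 SM]] := S_bounded.
apply: (@vanish_on_span (fun u => dot (S u) (e 0%N)) M) => [u u'|u|m c].
- by rewrite linearB dotBl.
- exact: le_trans (coef_le _ _) (SM _).
rewrite -(big_mkord xpredT (fun i => c i *: e i)) linear_sum /= !dot_sum_l.
by rewrite big1// => i _; rewrite linearZ /= HS.2 !dotZl !dot_basis !mulr0.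
Qed.

Lemma beta_gt0 n : 0 < beta w n.
Proof. by apply: prodr_gt0. Qed.

Lemma betaS n : beta w n.+1 = beta w n * w n.
Proof. by rewrite /beta big_ord_recr. Qed.

(** The coefficients of a solution are determined one after the other, by the
    recurrence [w n * dot v (e n) - l * dot v (e n.+1) = dot x (e n.+1)]; the
    factor [l ^+ n.+1] clears the denominators, so that [l = 0] is allowed. *)
Lemma solution_coef x l v n : S v - l *: v = x ->
  l ^+ n.+1 * dot v (e n) =
  - ((beta w n)%:C * \sum_(0 <= k < n.+1) dot x (e k) / (beta w k)%:C * l ^+ k).
Proof.
move=> xE.
have xk k : dot x (e k) = dot (S v) (e k) - l * dot v (e k).
  by rewrite -xE dotBl dotZl.
have bneq0 k : (beta w k)%:C != 0 :> R[i].
  by rewrite -[0]/((0 : R)%:C) (inj_eq (@complexI R)) gt_eqF ?beta_gt0.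
have cancel (b d p : R[i]) : b != 0 -> b * (d / b * p) = d * p.
  by move=> b0; field.
elim: n => [|n IH].
  rewrite big_nat1 xk shift_coef0 expr1 expr0 mulr1 mulrCA divff//; ring.
rewrite big_nat_recr//= mulrDr.
set P := \sum_(0 <= i < n.+1) _ in IH *.
have -> : (beta w n.+1)%:C * P = - ((w n)%:C * (l ^+ n.+1 * dot v (e n))).
  by rewrite IH betaS rmorphM /=; ring.
by rewrite cancel// xk shift_coefS exprS; ring.
Qed.

End Shift.

End Coefficients.

(** * Growth of the weights and of the coefficients *)

Section RootTest.
Variable R : realType.

Lemma limn_esup_lt (u : (\bar R)^nat) y : (limn_esup u < y)%E ->
  exists N, forall n, (N <= n)%N -> (u n < y)%E.
Proof.
move=> /ereal_inf_lt[_ [V [N _ NV] <-]] supV; exists N => n Nn.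
by apply: le_lt_trans supV; apply: ereal_sup_ubound; exists n => //; exact: NV.
Qed.

Lemma lt_limn_esup (u : (\bar R)^nat) y : (y < limn_esup u)%E ->
  forall N, exists2 n, (N <= n)%N & (y < u n)%E.
Proof.
move=> yu N; apply: contrapT => noex; move: yu; rewrite ltNge => /negP; apply.
have VN : [set ereal_sup (u @` V) | V in \oo] (ereal_sup (u @` [set n | (N <= n)%N])).
  by exists [set n | (N <= n)%N] => //; exists N.
apply: (le_trans (ereal_inf_lbound VN)).
apply: ge_ereal_sup => _ [n Nn <-]; rewrite leNgt; apply/negP => yun.
by apply: noex; exists n.
Qed.

Lemma lt_limn_einf (u : (\bar R)^nat) y : (y < limn_einf u)%E ->
  exists N, forall n, (N <= n)%N -> (y < u n)%E.
Proof.
rewrite /limn_einf lteNr => /limn_esup_lt[N hN]; exists N => n /hN.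
by rewrite lteN2.
Qed.

Lemma powR_invK (b : R) n : 0 <= b -> (b `^ n.+1%:R^-1) ^+ n.+1 = b.
Proof.
by move=> b0; rewrite -powR_mulrn ?powR_ge0// -powRrM mulVf ?pnatr_eq0// powRr1.
Qed.

(** The finitely many first terms are absorbed in the constant. *)
Lemma eventually_geometric (v : nat -> R) (q : R) N : 0 < q ->
  (forall n, 0 <= v n) -> (forall n, (N <= n)%N -> v n <= q ^+ n) ->
  exists C, forall n, v n <= C * q ^+ n.
Proof.
move=> q0 v0 vN; exists (1 + \sum_(i < N) v i / q ^+ i) => n.
have t0 i : 0 <= v i / q ^+ i by rewrite divr_ge0// exprn_ge0// ltW.
have [Nn|nN] := leqP N n.
  apply: le_trans (vN _ Nn) _; rewrite ler_peMl ?exprn_ge0 ?(ltW q0)//.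
  by rewrite lerDl sumr_ge0.
rewrite -ler_pdivrMr ?exprn_gt0// (bigD1 (Ordinal nN))//= addrCA lerDl.
by rewrite addr_ge0// sumr_ge0.
Qed.

Variable w : nat -> R.
Hypothesis w_gt0 : forall n, 0 < w n.

Lemma r3_lt_bound s : 0 < s -> (r3 w < s%:E)%E ->
  exists C, forall n, beta w n <= C * s ^+ n.
Proof.
move=> s0 /limn_esup_lt[N hN].
apply: (@eventually_geometric _ _ N.+1 s0) => [n|[//|n] Nn].
  exact/ltW/beta_gt0.
have b0 : 0 <= beta w n.+1 by exact/ltW/beta_gt0.
rewrite -{1}(powR_invK n b0) lerXn2r ?nnegrE ?powR_ge0 ?(ltW s0)//.
by apply/ltW; rewrite -lte_fin; apply: hN; exact: ltnW.
Qed.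

Lemma lt_r3_often s : 0 < s -> (s%:E < r3 w)%E ->
  forall N, exists2 n, (N <= n)%N & s ^+ n <= beta w n.
Proof.
move=> s0 /lt_limn_esup often N; have [[//|n] Nn sn] := often N.+1.
exists n.+1; first exact: ltnW.
have b0 : 0 <= beta w n.+1 by exact/ltW/beta_gt0.
rewrite -(powR_invK n b0) lerXn2r ?nnegrE ?powR_ge0 ?(ltW s0)//.
by rewrite ltW// -lte_fin.
Qed.

Lemma r3_ge0 : (0 <= r3 w)%E.
Proof.
apply: limf_esup_ge0; first by move=> [N _ /(_ N)]; apply; rewrite /=.
by move=> n; rewrite lee_fin powR_ge0.
Qed.

Lemma lt_R_omega_bound s a : 0 < s -> (s%:E < R_omega w a)%E ->
  exists C, coef_bound s C (fun k => a k / (beta w k)%:C).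
Proof.
move=> s0 /lt_limn_einf[N hN].
have [|||C HC] := @eventually_geometric (fun k => nrm (a k / (beta w k)%:C)) s^-1 N.+1.
- by rewrite invr_gt0.
- by move=> n; rewrite nrm_ge0.
- move=> [//|n] Nn; have := hN _ (ltnW Nn).
  have [->|an0] := eqVneq (a n.+1) 0.
    by rewrite mul0r nrm0 exprn_ge0// invr_ge0 ltW.
  rewrite -nrm_cabs lte_fin => sn.
  have -> : a n.+1 / (beta w n.+1)%:C = ((beta w n.+1)%:C / a n.+1)^-1.
    by rewrite invfM invrK mulrC.
  have p0 : 0 < s ^+ n.+1 by rewrite exprn_gt0.
  have le1 : s ^+ n.+1 <= nrm ((beta w n.+1)%:C / a n.+1).
    rewrite -(powR_invK n (nrm_ge0 ((beta w n.+1)%:C / a n.+1))).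
    by rewrite lerXn2r ?nnegrE ?powR_ge0 ?(ltW s0)// ltW.
  by rewrite nrmV exprVn lef_pV2 ?posrE// (lt_le_trans p0).
by exists C => k; rewrite -exprVn.
Qed.

End RootTest.

(** * The local spectrum of a weighted shift *)

Section LocalSpectrum.
Variables (R : realType) (H : completeNormedModType R[i]).
Variables (dot : {dot H for (@Num.conj R[i])}) (e : nat -> H).
Hypotheses (Hdot : inner_product_norm dot) (He : orthonormal_basis dot e).
Variables (w : nat -> R) (S : {linear H -> H}).
Hypotheses (w_gt0 : forall n, 0 < w n) (HS : weighted_shift e w S).
Variables (x : H) (a : nat -> R[i]).
Hypothesis Hx : series (fun n => a n *: e n) @ \oo --> x.

Implicit Types (l : R[i]) (s C : R) (v : H).

Let A k : R[i] := a k / (beta w k)%:C.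

Let solution_coefA l v n : S v - l *: v = x ->
  l ^+ n.+1 * dot v (e n) =
  - ((beta w n)%:C * series (fun k => A k * l ^+ k) n.+1).
Proof.
move=> /(solution_coef Hdot He w_gt0 HS n) ->; congr (- (_ * _)).
by apply: eq_bigr => k _; rewrite (coef_of_series Hdot He k Hx).
Qed.

Lemma coef0_eq0 : (forall k, A k = 0) -> x = 0.
Proof.
move=> A0; apply: (cvg_unique (@norm_hausdorff _ H) Hx).
rewrite (_ : series _ = fun=> 0); first exact: cvg_cst.
apply/funext => n; rewrite /series /= big1// => k _.
have /eqP := A0 k; rewrite /A mulf_eq0 invr_eq0 => /orP[/eqP ->|].
  by rewrite scale0r.
by rewrite -[0]/((0 : R)%:C) (inj_eq (@complexI R)) gt_eqF ?beta_gt0.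
Qed.

(** At the indices where [beta w n] is at least [s ^+ n], the partial sum is at
    most [nrm l * nrm v * (nrm l / s) ^+ n]. *)
Lemma solution_psum_eq0 s C l v : 0 < s -> coef_bound s C A ->
  (forall N, exists2 n, (N <= n)%N & s ^+ n <= beta w n) ->
  0 < nrm l -> nrm l < s -> S v - l *: v = x -> psum A l = 0.
Proof.
move=> s0 AC often l0 ls vx.
apply: nrm_eq0; apply/eqP; rewrite eq_le nrm_ge0 andbT leNgt; apply/negP => pos.
have q0 : 0 <= nrm l / s by rewrite divr_ge0// ltW.
have q1 : nrm l / s < 1 by rewrite ltr_pdivrMr ?mul1r.
have pos2 : 0 < nrm (psum A l) / 2 by rewrite divr_gt0.
have /cvg_nrmP/cvgr0Pnorm_lt/(_ _ pos2)[N1 _ hN1] := psum_cvg s0 AC ls.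
have /cvgr0Pnorm_lt/(_ _ pos2)[N2 _ hN2] :=
  cvg_scaled_geometric (nrm l * nrm v) q0 q1.
have [n Nn sn] := often (maxn N1 N2).
move: Nn; rewrite geq_max => /andP[N1n N2n].
have := hN1 n.+1 (leqW N1n); rewrite ger0_norm ?nrm_ge0// => h1.
have h2 := le_lt_trans (ler_norm _) (hN2 n N2n).
have b0 := beta_gt0 w_gt0 n.
have sp : 0 < s ^+ n by rewrite exprn_gt0.
have h3 : nrm (series (fun k => A k * l ^+ k) n.+1) <=
    nrm l * nrm v * (nrm l / s) ^+ n.
  have := congr1 (@nrm R R[i]) (solution_coefA n vx).
  rewrite nrmN !nrmM nrmX nrm_real ger0_norm ?(ltW b0)// => E.
  rewrite expr_div_n mulrA ler_pdivlMr//.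
  apply: le_trans (ler_wpM2l (nrm_ge0 _) sn) _.
  rewrite mulrC -E exprS mulrAC ler_wpM2r ?exprn_ge0 ?nrm_ge0//.
  by rewrite ler_wpM2l ?nrm_ge0// coef_le.
have := nrmD (psum A l - series (fun k => A k * l ^+ k) n.+1)
  (series (fun k => A k * l ^+ k) n.+1).
rewrite subrK => h4; lra.
Qed.

(** By induction on [k]: when the lower coefficients vanish, the formula for the
    [k]-th coefficient of the solution [f l] reduces to
    [l * dot (f l) (e k) = - beta w k * A k] for [l <> 0]; as the analytic
    function [f] is bounded near [0], letting [l] tend to [0] gives
    [A k = 0]. *)
Lemma local_resolvent0 : local_resolvent S x 0 -> x = 0.
Proof.
case=> U [Uo [f [fan fx]]] U0; have [c fc] := fan _ U0.
have [d d0 dball] : exists2 d : R, 0 < d & forall l : R[i], nrm l < d ->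
    U l /\ series (fun n => l ^+ n *: c n) @ \oo --> f l.
  have /nbhs_ballP[r r0] : nbhs (0 : R[i]) (U `&`
      [set l | series (fun n => (l - 0) ^+ n *: c n) @ \oo --> f l]).
    by apply: filterI => //; exact: open_nbhs_nbhs.
  have rE := gt0_realE r0.
  rewrite rE /= ltcR in r0 *; move=> rb; exists (complex.Re r) => // l lr.
  have [|Ul] := rb l; last by rewrite /= subr0.
  by rewrite -ball_normE /ball_ /= sub0r normrN nrmE ltcR.
(* Convergence at h bounds f on the disc of radius h / 2. *)
pose h : R := d / 2.
have h0 : 0 < h by rewrite divr_gt0.
have hd : nrm (h%:C : R[i]) < d by rewrite nrm_real ger0_norm /h; lra.
have [K cK] : exists K, forall n, nrm (c n) <= K * h^-1 ^+ n.
  have [_ /cvgP/cvg_series_cvg_0/cvg_nrmP/cvgr0Pnorm_lt/(_ _ ltr01)[N _ hN]] :=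
    dball _ hd.
  apply: (@eventually_geometric _ _ _ N); rewrite ?invr_gt0// => n.
    exact: nrm_ge0.
  move=> /hN /=; rewrite sub0r ger0_norm ?nrm_ge0// nrmN nrmZ nrmX nrm_real.
  rewrite ger0_norm ?(ltW h0)// => /ltW le1.
  by rewrite exprVn -[leRHS]mul1r ler_pdivlMr ?exprn_gt0// mulrC.
have f_le l : nrm l <= h / 2 -> nrm (f l) <= 2 * K.
  move=> lh; have [|_ fl] := dball l; first by rewrite /h in lh *; lra.
  have term n : nrm (l ^+ n *: c n) <= K * 2^-1 ^+ n.
    have -> : K * 2^-1 ^+ n = (h / 2) ^+ n * (K * h^-1 ^+ n).
      by rewrite mulrCA -exprMn mulrAC divff ?gt_eqF// mul1r.
    rewrite nrmZ nrmX; apply: ler_pM => //; rewrite ?exprn_ge0 ?nrm_ge0//.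
    by rewrite lerXn2r ?nnegrE ?nrm_ge0// divr_ge0// ltW.
  apply: cvg_nrm_bound fl _ => n.
  have := geometric_block_le _ _ term 0 n; rewrite expr0 mulr1.
  have -> : K / (1 - 2^-1) = 2 * K by field.
  by apply; lra.
apply: coef0_eq0 => k; elim/ltn_ind: k => k IH.
apply: nrm_eq0; apply/eqP; rewrite eq_le nrm_ge0 andbT.
have b0 := beta_gt0 w_gt0 k.
apply: (@le0_geometric _ _ (h / 2 * (2 * K) / beta w k) 2^-1) => [||n]; try lra.
pose l : R[i] := (h / 2 * 2^-1 ^+ n)%:C.
have l0 : 0 < h / 2 * 2^-1 ^+ n by rewrite mulr_gt0 ?divr_gt0// exprn_gt0.
have nl : nrm l = h / 2 * 2^-1 ^+ n by rewrite nrm_real ger0_norm// ltW.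
have lh : nrm l <= h / 2.
  rewrite nl ler_piMr ?divr_ge0 ?(ltW h0) ?(ltW d0)//.
  by rewrite exprn_ile1// ?invr_ge0// invf_le1// ler1n.
have [|Ul _] := dball l; first by rewrite /h in lh *; lra.
have lneq0 : nrm l != 0 by rewrite nl gt_eqF.
have E : nrm l * nrm (dot (f l) (e k)) = beta w k * nrm (A k).
  apply: (mulIf (expf_neq0 k lneq0)).
  have := congr1 (@nrm R R[i]) (solution_coefA k (fx _ Ul)).
  rewrite seriesSr /series /= big_nat big1 ?add0r; last first.
    by move=> i /andP[_ ik]; rewrite IH// mul0r.
  rewrite nrmN [LHS]nrmM [RHS]nrmM [nrm (A k * _)]nrmM !nrmX.
  rewrite (nrm_real (beta w k)) ger0_norm ?(ltW b0)// => E0.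
  by rewrite mulrAC -exprS E0 mulrA.
rewrite mulrAC ler_pdivlMr// [leLHS]mulrC -E [leRHS]mulrAC -nl.
by rewrite ler_wpM2l ?nrm_ge0//; apply: le_trans (coef_le Hdot He _ _) (f_le _ lh).
Qed.

End LocalSpectrum.

Section LocalSpectrumDiscs.
Variables (R : realType) (H : completeNormedModType R[i]).
Variables (dot : {dot H for (@Num.conj R[i])}) (e : nat -> H).
Hypotheses (Hdot : inner_product_norm dot) (He : orthonormal_basis dot e).
Variables (w : nat -> R) (S : {linear H -> H}).
Hypotheses (w_gt0 : forall n, 0 < w n) (HS : weighted_shift e w S).
Variables (x : H) (a : nat -> R[i]).
Hypothesis Hx : series (fun n => a n *: e n) @ \oo --> x.
Implicit Types (l z : R[i]) (s : R).

(** The point [l0] may lie on the circle of radius [r3] or [R_omega], so the zeros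
    of the power series are found around a point [z0] slightly closer to [0] on
    the same ray, in a disc still contained in the neighbourhood of [l0] and
    away from [0]. *)
Lemma disc_subset_local_spectrum l0 : x <> 0 ->
  ((cabs l0)%:E <= r3 w)%E -> ((cabs l0)%:E <= R_omega w a)%E ->
  local_spectrum S x l0.
Proof.
move=> x0; rewrite -nrm_cabs => l0r l0R resl0.
have [l00|l0neq0] := eqVneq l0 0.
  by apply: x0; apply: (local_resolvent0 Hdot He w_gt0 HS Hx); rewrite -l00.
have [U [Uo [f [_ fx]]] Ul0] := resl0.
have /nbhs_ballP[r r0 rb] : nbhs l0 U by exact: open_nbhs_nbhs.
have rE := gt0_realE r0.
rewrite rE /= ltcR in r0 rb.
have n0 := nrm_gt0 l0neq0.
(* With z0 at distance 2 * d from l0, the disc of radius d around z0 stays in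
   the ball of radius r around l0, in the disc of radius nrm l0 - d, and away
   from 0. *)
pose d := Num.min (complex.Re r) (nrm l0) / 4.
have d0 : 0 < d by rewrite divr_gt0// lt_min r0.
have dr : 4 * d <= complex.Re r.
  by rewrite /d mulrC divfK// ge_min lexx.
have dl : 4 * d <= nrm l0.
  by rewrite /d mulrC divfK// ge_min lexx orbT.
pose z0 := (1 - 2 * d / nrm l0)%:C * l0.
have z0n : nrm z0 = nrm l0 - 2 * d.
  rewrite nrmM nrm_real ger0_norm.
    by rewrite mulrBl mul1r divfK ?gt_eqF.
  by rewrite subr_ge0 ler_pdivrMr//; lra.
have z0l0 : nrm (z0 - l0) = 2 * d.
  have -> : z0 - l0 = - (2 * d / nrm l0)%:C * l0.
    by rewrite /z0 rmorphB rmorph1; ring.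
  rewrite nrmM nrmN nrm_real ger0_norm ?divfK ?gt_eqF//.
  by rewrite divr_ge0//; lra.
pose s := nrm l0 - d.
have s0 : 0 < s by rewrite /s; lra.
have sl0 : (s%:E < (nrm l0)%:E)%E by rewrite lte_fin /s; lra.
have [C AC] := lt_R_omega_bound s0 (lt_le_trans sl0 l0R).
have often := lt_r3_often w_gt0 s0 (lt_le_trans sl0 l0r).
apply: x0; apply: (coef0_eq0 w_gt0 Hx).
apply: (identity_theorem s0 AC (z0 := z0) (d := d)) => //; first by rewrite /s; lra.
move=> z zd.
have zU : U z.
  apply: rb; rewrite -ball_normE /ball_ /= nrmE ltcR nrm_distC.
  by have := nrmD (z - z0) (z0 - l0); rewrite subrKA; lra.
have h1 := nrmD (z - z0) z0; have h2 := nrmB z (z - z0).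
rewrite subrK in h1; rewrite opprB addrC subrK in h2.
apply: (solution_psum_eq0 Hdot He w_gt0 HS Hx s0 AC often _ _ (fx _ zU)).
  by lra.
by rewrite /s; lra.
Qed.

Lemma iter_shift_basis j k :
  iter j S (e k) = (beta w (k + j) / beta w k)%:C *: e (k + j)%N.
Proof.
have b0 n : beta w n != 0 by rewrite gt_eqF// beta_gt0.
elim: j => [|j IH]; first by rewrite addn0 divff// scale1r.
rewrite iterS IH linearZ /= HS.2 scalerA -rmorphM addnS; congr (_%:C *: _).
by rewrite betaS mulrAC.
Qed.

(** Expanding [iter j S x] along the basis, the [k]-th term has norm at most
    [(C / t ^+ k) * (C1 * s ^+ (k + j))]; the factor [s ^+ j] comes out and the
    rest is geometric of ratio [s / t]. *)
Lemma local_resolvent_outside l :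
  (r3 w < R_omega w a)%E -> (r3 w < (cabs l)%:E)%E -> local_resolvent S x l.
Proof.
rewrite -nrm_cabs => rR rl.
have [s [t [rs [st [tR tl]]]]] : exists s t : R,
    (r3 w < s%:E)%E /\ s < t /\ (t%:E < R_omega w a)%E /\ t < nrm l.
  move: rR rl; have := r3_ge0 w; case: (r3 w) => [r| |]//= _ rR.
  rewrite lte_fin => rl.
  have [m [rm mR ml]] : exists m : R, [/\ r < m, (m%:E <= R_omega w a)%E & m <= nrm l].
    move: rR; case: (R_omega w a) => [q| |]//= rq.
      exists (Num.min q (nrm l)); rewrite lt_min rl andbT -lte_fin rq lee_fin.
      by rewrite !ge_min !lexx orbT.
    by exists (nrm l); rewrite leey lexx rl.
  exists (r + (m - r) / 3), (r + (m - r) / 3 * 2); rewrite lte_fin.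
  split; [lra|split; [lra|split; [|lra]]].
  by apply: lt_le_trans mR; rewrite lte_fin; lra.
have s0 : 0 < s.
  by rewrite -lte_fin; apply: le_lt_trans rs; exact: r3_ge0.
have t0 := lt_trans s0 st.
have [C1 bC] := r3_lt_bound w_gt0 s0 rs.
have [C AC] := lt_R_omega_bound t0 tR.
have q0 : 0 <= s / t by rewrite divr_ge0// ltW.
have q1 : s / t < 1 by rewrite ltr_pdivrMr// mul1r.
have Sb := HS.1.
have orbit : orbit_bound S s (C * C1 / (1 - s / t)) x.
  move=> j.
  have term k : nrm (iter j S (a k *: e k)) <= C * C1 * s ^+ j * (s / t) ^+ k.
    rewrite iter_linearZ iter_shift_basis scalerA nrmZ (nrm_basis Hdot He) mulr1.
    have -> : a k * (beta w (k + j) / beta w k)%:C =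
        a k / (beta w k)%:C * (beta w (k + j))%:C.
      by rewrite rmorphM fmorphV mulrCA mulrC.
    have -> : C * C1 * s ^+ j * (s / t) ^+ k = C / t ^+ k * (C1 * s ^+ (k + j)).
      by rewrite exprD expr_div_n; ring.
    rewrite nrmM nrm_real ger0_norm; last exact/ltW/beta_gt0.
    by apply: ler_pM; rewrite ?nrm_ge0//; exact/ltW/beta_gt0.
  have := iter_bounded_cvg Sb (k := j) Hx; move/cvg_nrm_bound; apply => n.
  rewrite /series /= iter_linear_sum.
  apply: le_trans (geometric_block_le q0 q1 term 0 n) _.
  by rewrite expr0 mulr1 mulrAC.
exact: (orbit_bound_local_resolvent Sb (ltW s0) orbit (lt_trans st tl)).
Qed.

End LocalSpectrumDiscs.

Theorem theorem3p5 (R : realType) (H : completeNormedModType R[i])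
    (dot : {dot H for (@Num.conj R[i])}) (e : nat -> H) (w : nat -> R)
    (S : {linear H -> H})
    (Hdot : inner_product_norm dot)
    (He : orthonormal_basis dot e)
    (w_gt0 : forall n, 0 < w n)
    (w_bounded : bounded_fun w)
    (HS : weighted_shift e w S)
    (x : H) (a : nat -> R[i])
    (x_neq0 : x <> 0)
    (Hx : series (fun n => a n *: e n) @ \oo --> x) :
  ((r3 w < R_omega w a)%E -> local_spectrum S x = closed_disc (r3 w)) /\
  ((R_omega w a <= r3 w)%E -> closed_disc (R_omega w a) `<=` local_spectrum S x).
Proof.
split=> [rR|Rr l lR].
  apply/seteqP; split=> [l lspec|l lr].
    rewrite /closed_disc /= leNgt; apply/negP => rl; apply: lspec.
    exact: (local_resolvent_outside Hdot He w_gt0 HS Hx rR rl).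
  apply: (disc_subset_local_spectrum Hdot He w_gt0 HS Hx x_neq0 lr).
  exact: le_trans lr (ltW rR).
apply: (disc_subset_local_spectrum Hdot He w_gt0 HS Hx x_neq0 _ lR).
exact: le_trans lR Rr.
Qed.
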